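(* Let $X$ and $Y$ be two nonempty abelian Polish groups. Let $\mathcal{I}$ stand for $[2^\omega]^{\leq\omega}$, $[2^\omega]^{<\omega}$ or $[2^\omega]^{\leq n}$ for some $n\in\omega$. Suppose that $A\subseteq X$ is closed and such that $A\cap U$ is not Haar-$\mathcal{I}$ in $X$ for each open $U\subseteq X$ with $A\cap U\neq\emptyset$. Then $A\times Y$ does not belong to the $\sigma$-ideal generated by the closed Haar-$\mathcal{I}$ subsets of $X\times Y$.
   Context: $\omega=\{0,1,2,\ldots\}$. $[2^\omega]^{\leq\omega}$, $[2^\omega]^{<\omega}$ and $[2^\omega]^{\leq n}$ denote the families of at most countable subsets, finite subsets, and subsets of cardinality at most $n$ of the Cantor cube $2^\omega$, respectively. For a collection $\mathcal{I}$ of subsets of $2^\omega$ closed under taking subsets, a subset $A$ of an abelian Polish group $X$ is Haar-$\mathcal{I}$ if there are a Borel set $B\subseteq X$ with $A\subseteq B$ and a continuous map $f\colon 2^\omega\to X$ with $f^{-1}[B+x]\in\mathcal{I}$ for all $x\in X$. The $\sigma$-ideal generated by a family $\mathcal{A}$ of sets is the family of sets which can be covered by a countable union of elements of $\mathcal{A}$.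
   Formalization: The set A is additionally assumed nonempty: for A empty the hypothesis holds vacuously, while A × Y is empty and belongs to every σ-ideal, so the claim as worded fails. *)

(* Defs.v *)
From HB Require Import structures.
From mathcomp Require Import all_boot all_order all_algebra.
From mathcomp Require Import all_classical all_reals all_analysis.

Set Implicit Arguments.
Unset Strict Implicit.
Unset Printing Implicit Defensive.

Import GRing.Theory Num.Theory.
Local Open Scope classical_set_scope.
Local Open Scope ring_scope.

Definition is_metric (R : realType) (T : Type) (d : T -> T -> R) : Prop :=
  [/\ forall x y, 0 <= d x y,
      forall x y, d x y = 0 <-> x = y,
      forall x y, d x y = d y x &
      forall x y z, d x z <= d x y + d y z].

Definition metric_compatible (R : realType) (T : topologicalType)
    (d : T -> T -> R) : Prop :=
  forall U : set T, open U <->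
    (forall x, U x -> exists2 e : R, 0 < e & [set y | d x y < e] `<=` U).

Definition metric_complete (R : realType) (T : topologicalType)
    (d : T -> T -> R) : Prop :=
  forall u : nat -> T,
    (forall e : R, 0 < e ->
      exists N, forall m n, (N <= m)%N -> (N <= n)%N -> d (u m) (u n) < e) ->
    exists l : T, u @ \oo --> l.

Definition polish (R : realType) (T : topologicalType) : Prop :=
  (exists2 D : set T, countable D & dense D) /\
  exists d : T -> T -> R,
    [/\ is_metric d, metric_compatible d & metric_complete d].

(* MathComp-Analysis makes products of topological vector spaces, but not of
   topological abelian groups; as the carrier key [prod] is already taken by
   that instance, the product group is a named structure on X * Y. *)
Section prod_group.
Variables X Y : topologicalZmodType.

Lemma prod_sub_continuous :
  continuous (fun p : (X * Y) * (X * Y) => p.1 - p.2).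
Proof.
move=> [[x1 y1] [x2 y2]] /= U [] [A B] /= [nA nB] AB_U.
have [/= C [C1 C2] CA] := @sub_continuous X (x1, x2) _ nA.
have [/= D [D1 D2] DB] := @sub_continuous Y (y1, y2) _ nB.
exists (C.1 `*` D.1, C.2 `*` D.2).
  by split; [exists (C.1, D.1)|exists (C.2, D.2)].
move=> [[u1 v1] [u2 v2]] /= [] [Cu1 Dv1] [Cu2 Dv2].
by apply: AB_U; split; [exact: (CA (u1, u2))|exact: (DB (v1, v2))].
Qed.

Definition prod_topologicalZmod : topologicalZmodType :=
  HB.pack (X * Y)%type
    (PreTopologicalNmodule_isTopologicalZmodule.Build (X * Y)%type
      prod_sub_continuous).

End prod_group.

Definition borel (T : topologicalType) : set (set T) := <<s @open T >>.

Definition translate (X : zmodType) (B : set X) (x : X) : set X :=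
  [set b + x | b in B].

Definition haar (X : topologicalZmodType) (I : set (set cantor_space))
    (A : set X) : Prop :=
  exists B : set X, [/\ borel B, A `<=` B &
    exists2 f : cantor_space -> X, continuous f &
      forall x : X, I (f @^-1` translate B x)].

(* The countable union may be empty. *)
Definition sigma_ideal_generated (T : Type) (F : set (set T)) : set (set T) :=
  [set A | exists G : set (set T),
    [/\ countable G, G `<=` F & A `<=` \bigcup_(C in G) C]].

Definition countable_subsets : set (set cantor_space) :=
  [set C | countable C].

Definition finite_subsets : set (set cantor_space) :=
  [set C | finite_set C].

Definition subsets_card_le (n : nat) : set (set cantor_space) :=
  [set C | (C #<= `I_n)%card].

(* Main.v *)
Require Import Defs.
From mathcomp Require Import all_boot all_order all_algebra.
From mathcomp Require Import all_classical all_reals all_analysis.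
From mathcomp Require Import lra.

Import Order.TTheory GRing.Theory Num.Theory.

Local Open Scope classical_set_scope.
Local Open Scope ring_scope.

(** If countably many closed Haar-I sets cover the Polish space A x Y, then by
    Baire one of them contains a nonempty relatively open box (A `&` U) x V.
    Let (f1, f2) be its Haar-I witness, and restrict it to a cylinder of the
    Cantor space, itself a copy of the Cantor space, which f2 maps into a
    translate of V. On this cylinder the second coordinate imposes no
    condition, so f1 witnesses that A `&` U is Haar-I in X. *)

(** * Balls and Baire category on closed sets *)

Lemma metric_open_ball {R : realType} {T : topologicalType} {d : T -> T -> R} :
  is_metric d -> metric_compatible d ->
  forall x r, open [set y | d x y < r].
Proof.
move=> [d0 deq dC dT] dU x r; apply/dU => y /= dxy.
exists (r - d x y); first by rewrite subr_gt0.
by move=> z /= dyz; have := dT x y z; lra.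
Qed.

Lemma metric_closed_ball {R : realType} {T : topologicalType}
    {d : T -> T -> R} :
  is_metric d -> metric_compatible d ->
  forall x r, closed [set y | d x y <= r].
Proof.
move=> [d0 deq dC dT] dU x r; rewrite -openC; apply/dU => y /= /negP.
rewrite -ltNge => rxy.
exists (d x y - r); first by rewrite subr_gt0.
move=> z /= dyz; apply/negP; rewrite -ltNge.
by have := dT x z y; rewrite (dC z y); lra.
Qed.

(** Otherwise one builds decreasing closed balls centred in [S], the one of index [n.+1] missing
    [F n], with radii tending to 0. Their centres converge to a point of [S] outside every [F n]. *)
Lemma metric_baire_closed {R : realType} {T : topologicalType}
    {d : T -> T -> R} (S : set T) (F : nat -> set T) :
  is_metric d -> metric_compatible d -> metric_complete d ->
  closed S -> S !=set0 -> (forall n, closed (F n)) ->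
  S `<=` \bigcup_n F n ->
  exists n, exists2 W, open W & W `&` S !=set0 /\ W `&` S `<=` F n.
Proof.
move=> dm dU dc clS [x0 Sx0] clF SF; apply: contrapT => noW.
have [d0 deq dC dT] := dm.
pose good (p : T * R) := S p.1 /\ 0 < p.2.
(* The premise [good np.2] stands under the existential so that [choice] gives a total function; its
   values at pairs that are not good are arbitrary. *)
have step (np : nat * (T * R)) : exists q : T * R, good np.2 ->
    [/\ good q, q.2 <= np.1.+1%:R^-1 &
      [set y | d q.1 y <= q.2] `<=`
        [set y | d np.2.1 y < np.2.2] `\` F np.1].
  case: np => n [x r] /=.
  have [[/= Sx r0]|] := pselect (good (x, r)); last by exists (x, r).
  have oB := metric_open_ball dm dU x r.
  have [z [[dz Sz] Fz]] :
      exists z, ([set y | d x y < r] `&` S) z /\ ~ F n z.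
    apply: contrapT => /forallNP h; apply: noW; exists n.
    exists [set y | d x y < r] => //; split; last first.
      by move=> z Sz; apply: contrapT => Fz; exact: (h z).
    by exists x; split => //=; rewrite (deq x x).2.
  have oD : open ([set y | d x y < r] `\` F n).
    by rewrite setDE; apply: openI => //; rewrite openC.
  have [e e0 eD] := (dU _).1 oD z (conj dz Fz).
  (* Halving [e] fits the closed ball into the open one of radius [e]; the other bound makes the
     radii tend to 0. *)
  exists (z, Num.min (e / 2) n.+1%:R^-1) => _; split => /=.
  - by split=> //=; rewrite lt_min divr_gt0//= invr_gt0.
  - by rewrite ge_min lexx orbT.
  - move=> y /=; rewrite le_min => /andP[h _]; apply: eD => /=.
    by lra.
have {step} [g gP] := choice step.
pose q := fix q n := if n is m.+1 then g (m, q m) else (x0, 1 : R).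
have qgood n : good (q n).
  by elim: n => [|n ih]; [split => /=|have [] := gP (n, q n) ih].
have qS n : (q n.+1).2 <= n.+1%:R^-1 by have [] := gP (n, q n) (qgood n).
have qB n : [set y | d (q n.+1).1 y <= (q n.+1).2] `<=`
    [set y | d (q n).1 y < (q n).2] `\` F n.
  by have [] := gP (n, q n) (qgood n).
have nested n k :
    [set y | d (q (k + n)%N).1 y <= (q (k + n)%N).2] `<=`
    [set y | d (q n).1 y <= (q n).2].
  elim: k => [//|k ih] y /(qB (k + n)%N) [/= h _]; apply: ih => /=.
  exact: ltW.
have inball n m : (n <= m)%N -> d (q n).1 (q m).1 <= (q n).2.
  move=> nm; rewrite -(subnK nm); apply: nested => /=.
  by rewrite (deq _ _).2//; case: (qgood (m - n + n)%N) => _ /ltW.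
have [|l ul] := dc (fun n => (q n).1).
  move=> e e0.
  have [N _ /(_ N (leqnn N)) /= Ne] :
      \forall n \near \oo, n.+1%:R^-1 < e / 2.
    have e20 : 0 < e / 2 by lra.
    exact: (near_infty_natSinv_lt (PosNum e20)).
  (* From this index on, all centres lie in the closed ball of index [N.+1], whose radius is below
     [e / 2]. *)
  exists N.+1 => m n Nm Nn.
  have := inball _ _ Nm; have := inball _ _ Nn.
  have := le_lt_trans (qS N) Ne; have := dT (q m).1 (q N.+1).1 (q n).1.
  by rewrite (dC (q m).1 (q N.+1).1); lra.
have Sl : S l.
  by apply: (closed_cvg S clS _ l ul); apply: nearW => n; case: (qgood n).
have [n _ Fl] := SF l Sl.
(* The limit stays in each closed ball, and that of index [n.+1] misses [F n]. *)
suff : [set y | d (q n.+1).1 y <= (q n.+1).2] l by move=> /qB [].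
apply: (closed_cvg _ (metric_closed_ball dm dU _ _) _ l ul).
by exists n.+1 => // m /= nm; exact: (inball n.+1).
Qed.

(** * The maximum metric on a product *)

(** With the maximum, open balls are boxes whose sides are balls of the same radius. *)
Definition prod_metric {R : realType} {X Y : Type} (dX : X -> X -> R)
    (dY : Y -> Y -> R) (p q : X * Y) : R :=
  Num.max (dX p.1 q.1) (dY p.2 q.2).

Lemma is_metric_prod {R : realType} {X Y : Type} {dX : X -> X -> R}
    {dY : Y -> Y -> R} :
  is_metric dX -> is_metric dY -> is_metric (prod_metric dX dY).
Proof.
move=> [x0 xe xC xT] [y0 ye yC yT]; rewrite /prod_metric; split.
- by move=> p q; rewrite le_max x0.
- move=> [x y] [x' y'] /=; split; last first.
    by move=> [-> ->]; rewrite (xe _ _).2// (ye _ _).2// maxxx.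
  move=> h; have : dX x x' <= 0 /\ dY y y' <= 0.
    by rewrite -h !le_max !lexx orbT.
  move=> [hx hy]; congr pair.
  + by apply/xe/le_anti; rewrite hx x0.
  + by apply/ye/le_anti; rewrite hy y0.
- by move=> p q; rewrite xC yC.
- move=> p q r; rewrite ge_max; apply/andP; split.
  + by apply: (le_trans (xT _ q.1 _)); rewrite lerD// le_max lexx.
  + by apply: (le_trans (yT _ q.2 _)); rewrite lerD// le_max lexx orbT.
Qed.

Lemma metric_compatible_prod {R : realType} {X Y : topologicalType}
    {dX : X -> X -> R} {dY : Y -> Y -> R} :
  is_metric dX -> is_metric dY ->
  metric_compatible dX -> metric_compatible dY ->
  metric_compatible (T := (X * Y)%type) (prod_metric dX dY).
Proof.
move=> mX mY cX cY U; split.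
  rewrite openE => oU [x y] /oU [[P Q] /= []].
  rewrite !nbhsE => -[P' [oP' P'x] P'P] [Q' [oQ' Q'y] Q'Q] PQU.
  have [e e0 eP] := (cX _).1 oP' _ P'x.
  have [e' e'0 eQ] := (cY _).1 oQ' _ Q'y.
  exists (Num.min e e'); first by rewrite lt_min e0.
  move=> [x' y'] /=; rewrite /prod_metric/= gt_max !lt_min.
  move=> /andP[/andP[h1 _] /andP[_ h2]]; apply: PQU; split => /=.
  - exact/P'P/eP.
  - exact/Q'Q/eQ.
move=> h; rewrite openE => -[x y] /h [e e0 eU].
exists ([set x' | dX x x' < e], [set y' | dY y y' < e]) => /=.
  split; apply: open_nbhs_nbhs; split => /=.
  - exact: metric_open_ball.
  - by have [_ xe _ _] := mX; rewrite (xe _ _).2.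
  - exact: metric_open_ball.
  - by have [_ ye _ _] := mY; rewrite (ye _ _).2.
by move=> [x' y'] /= [h1 h2]; apply: eU; rewrite /= /prod_metric gt_max h1.
Qed.

Lemma metric_complete_prod {R : realType} {X Y : topologicalType}
    {dX : X -> X -> R} {dY : Y -> Y -> R} :
  metric_complete dX -> metric_complete dY ->
  metric_complete (T := (X * Y)%type) (prod_metric dX dY).
Proof.
move=> cX cY u cu.
have [|l1 ul1] := cX (fun n => (u n).1).
  move=> e /cu[N Ne]; exists N => m n Nm Nn.
  by have := Ne m n Nm Nn; rewrite gt_max => /andP[].
have [|l2 ul2] := cY (fun n => (u n).2).
  move=> e /cu[N Ne]; exists N => m n Nm Nn.
  by have := Ne m n Nm Nn; rewrite gt_max => /andP[].
exists (l1, l2).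
have -> : u = (fun n => ((u n).1, (u n).2)).
  by apply/funext => n; case: (u n).
exact: cvg_pair.
Qed.

(** * Cylinders of the Cantor space *)

Definition cylinder_embedding (p : cantor_space) (n : nat)
    (t : cantor_space) : cantor_space :=
  fun i => if (i < n)%N then p i else t (i - n)%N.

Lemma cylinder_embedding_inj (p : cantor_space) (n : nat) :
  injective (cylinder_embedding p n).
Proof.
move=> s t st; apply/funext => i.
have := congr1 (fun f : cantor_space => f (i + n)%N) st.
by rewrite /cylinder_embedding ltnNge leq_addl /= addnK.
Qed.

(** The product topology is the supremum of the initial topologies of the coordinates, so open sets
    constraining a single coordinate suffice. *)
Lemma cantor_cvg (F : set_system cantor_space) (t : cantor_space) :
  Filter F -> (forall i, (fun s : cantor_space => s i) @ F --> t i) ->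
  F --> t.
Proof.
move=> FF h; apply/cvg_sup => i U.
set W := initial_topology _.
have /= -> := @nbhsE W t.
case=> B [[C oC <-] Ct] /filterS; apply.
apply: (h i); apply: open_nbhs_nbhs; split => //.
Qed.

Lemma cylinder_embedding_continuous (p : cantor_space) (n : nat) :
  continuous (cylinder_embedding p n).
Proof.
move=> t; apply: cantor_cvg => i.
suff : cylinder_embedding p n s i @[s --> t] --> cylinder_embedding p n t i.
  by [].
rewrite /cylinder_embedding; case: ltnP => _; first exact: cvg_cst.
exact: (@proj_continuous nat (fun=> bool) (i - n)%N t).
Qed.

(** Points outside [O], one in each cylinder around [p], would agree with [p] on ever longer
    prefixes and so converge to [p]. *)
Lemma cylinder_embedding_nbhs (p : cantor_space) (O : set cantor_space) :
  nbhs p O -> exists n, forall t, O (cylinder_embedding p n t).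
Proof.
move=> pO; apply: contrapT => /forallNP h.
have {h} /choice [t tP] n : exists t, ~ O (cylinder_embedding p n t).
  exact/existsNP.
have : (fun n => cylinder_embedding p n (t n)) @ \oo --> p.
  apply: cantor_cvg => i; apply: cvg_near_cst.
  by exists i.+1 => // n /= ni; rewrite /cylinder_embedding ni.
by move=> /(_ O pO) [N _ /(_ N (leqnn N))]; exact: tP.
Qed.

(** * Borel sets and Haar-small boxes *)

Lemma card_le_preimage_inj {T U : Type} (h : T -> U) (C : set U) :
  injective h -> (h @^-1` C #<= C)%card.
Proof.
move=> hi; rewrite -(card_le_eql (inj_card_eq (in2W hi))).
by apply: subset_card_le => _ [x Cx <-].
Qed.

Lemma borel_open {T : topologicalType} (U : set T) : open U -> borel U.
Proof. by move=> oU; exact: sub_sigma_algebra. Qed.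

Lemma borel_closed {T : topologicalType} (F : set T) : closed F -> borel F.
Proof.
rewrite -openC => /borel_open bF; rewrite -[F]setCK -setTD.
by have [_ + _] := smallest_sigma_algebra setT (@open T); apply.
Qed.

Lemma borel_setI {T : topologicalType} (A B : set T) :
  borel A -> borel B -> borel (A `&` B).
Proof.
have [//|_ _ _] := (sigma_algebraP (U := setT) (C := @borel T) _).1
  (smallest_sigma_algebra _ _).
by apply.
Qed.

(** [I] is assumed monotone in cardinality, not just in inclusion, because preimages under the
    cylinder embedding sit elsewhere in the Cantor space. *)
Lemma haar_prod_open {X Y : topologicalZmodType} (I : set (set cantor_space))
    (A : set X) (V : set Y) :
  (forall C D, (D #<= C)%card -> I C -> I D) ->
  borel A -> open V -> V !=set0 ->
  haar I (A `*` V : set (prod_topologicalZmod X Y)) -> haar I A.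
Proof.
move=> Isub bA oV [v Vv] [B [_ AVB [f cf fI]]].
exists A; split=> //.
have cf1 : continuous (fst \o f).
  by move=> t; apply: continuous_comp; [exact: cf|exact: cvg_fst].
have cf2 : continuous (snd \o f).
  by move=> t; apply: continuous_comp; [exact: cf|exact: cvg_snd].
pose p : cantor_space := fun=> false.
(* Chosen so that [(f p).2 - c] is [v]; by continuity [(f t).2 - c] stays in [V] on a cylinder
   around [p]. *)
pose c := (f p).2 - v.
have cg : continuous (fun t => (f t).2 - c).
  move=> t.
  apply: (@continuous2_cvg _ _ _ _ _ _ (snd \o f) (fun=> c) (fun y z => y - z)).
  - exact: (@sub_continuous Y ((f t).2, c)).
  - exact: cf2.
  - exact: cvg_cst.
have [|n nV] := cylinder_embedding_nbhs p [set t | V ((f t).2 - c)].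
  by apply: cg; apply: open_nbhs_nbhs; split; rewrite // /c opprB subrKC.
set h := cylinder_embedding p n in nV.
exists (fst \o f \o h).
  move=> t; apply: continuous_comp; last exact: cf1.
  exact: cylinder_embedding_continuous.
(* If [a + x] is the first coordinate of [f (h t)] with [a] in [A], then [f (h t)] is the translate
   by [(x, c)] of a point of [A]*[V], hence of [B]. *)
move=> x; apply: (Isub _ _ _ (fI ((x, c) : prod_topologicalZmod X Y))).
apply: (card_le_trans _ (card_le_preimage_inj h _ _)); last first.
  exact: cylinder_embedding_inj.
apply: subset_card_le => t [a Aa ax].
exists (a, (f (h t)).2 - c); first by apply: AVB; split => //; exact: nV.
rewrite [RHS]surjective_pairing; apply: (congr2 pair); first exact: ax.
exact: subrK.
Qed.

Theorem proposition2p6 (R : realType) (X Y : topologicalZmodType)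
  (polishX : polish R X) (polishY : polish R Y)
  (I : set (set cantor_space))
  (hI : [\/ I = countable_subsets, I = finite_subsets |
            exists n : nat, I = subsets_card_le n])
  (A : set X) (A0 : A !=set0) (closedA : closed A)
  (hA : forall U : set X, open U -> A `&` U !=set0 -> ~ haar I (A `&` U)) :
  ~ sigma_ideal_generated
      [set F : set (prod_topologicalZmod X Y) | closed F /\ haar I F]
      (A `*` [set: Y]).
Proof.
move=> [G [cG GF AG]].
have Isub C D : (D #<= C)%card -> I C -> I D.
  move=> DC; case: hI => [->|->|[n ->]].
  - exact: sub_countable.
  - exact: card_le_finite.
  - exact: card_le_trans.
have [a Aa] := A0.
(* Either [G] is empty, and then it cannot cover the nonempty product, or [F] enumerates it. *)
have [G0|[F]] := pfcard_geP cG.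
  by have [] := AG (a, 0) (conj Aa Logic.I); rewrite G0.
have [_ [dX [mX cX lX]]] := polishX; have [_ [dY [mY cY lY]]] := polishY.
have GFn n : G (F n) by exact: funS.
have clAY : closed (A `*` [set: Y] : set (X * Y)%type).
  by rewrite setXT; apply: closed_comp => // z _; exact: cvg_fst.
have [|||n [W oW [[[x y] [Wxy [Ax _]]] WF]]] :=
  metric_baire_closed (A `*` [set: Y]) F (is_metric_prod mX mY)
    (metric_compatible_prod mX mY cX cY) (metric_complete_prod lX lY) clAY.
- by exists (a, 0).
- by move=> n; case: (GF _ (GFn n)).
- move=> z /AG [C GC Cz]; have [m _ FmC] := 'surj_F GC.
  by exists m => //; rewrite FmC.
move: oW; rewrite openE => /(_ _ Wxy) [[P Q] /= []].
rewrite !nbhsE => -[U [oU Ux] UP] [V [oV Vy] VQ] PQW.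
apply: (hA U oU); first by exists x.
apply: (haar_prod_open _ _ V Isub _ oV) => //.
- by apply: borel_setI; [exact: borel_closed|exact: borel_open].
- by exists y.
have [_ [B [bB FB fB]]] := GF _ (GFn n).
(* The box lies in [F n], so the hull and the witness map of [F n] serve for it. *)
exists B; split=> //; apply: subset_trans FB => -[x' y'] [/= [Ax' Ux'] Vy'].
by apply: WF; split => //; apply: PQW; split; [exact: UP|exact: VQ].
Qed.
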